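(* Let $r \geq 4$ be an integer, and let $G$ be a connected graph on $n$ vertices containing no clique of size $r$. Then $t(G) \geq \frac{\log n}{4 \log r}$, where $t(G)$ denotes the maximum number of vertices in an induced subgraph of $G$ that is a tree.
   Context: All graphs are finite and simple. For a graph $G$, $t(G)$ is the maximum number of vertices of an induced subgraph of $G$ which is a tree. The base of the logarithm is irrelevant since it appears in both numerator and denominator. *)

(* Defs.v *)
From HB Require Import structures.
From mathcomp Require Import all_boot all_order all_algebra.
From mathcomp Require Import boolp reals exp.

Set Implicit Arguments.
Unset Strict Implicit.
Unset Printing Implicit Defensive.

Record sgraph := SGraph {
  vertex :> finType;
  adj : rel vertex;
  adj_sym : symmetric adj;
  adj_irrefl : irreflexive adj
}.

Section Induced.
Variables (G : sgraph) (S : {set G}).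

Definition induced_adj : rel {x : G | x \in S} :=
  fun x y => adj (val x) (val y).

Lemma induced_adj_sym : symmetric induced_adj.
Proof. by move=> x y; exact: adj_sym. Qed.

Lemma induced_adj_irrefl : irreflexive induced_adj.
Proof. by move=> x; exact: adj_irrefl. Qed.

Definition induced : sgraph := SGraph induced_adj_sym induced_adj_irrefl.

End Induced.

Definition is_connected (G : sgraph) : Prop :=
  (0 < #|G|)%N /\ forall x y : G, connect (@adj G) x y.

(* Closed walks of length 2 along a single edge also satisfy ucycle, hence
   the bound on the size. *)
Definition is_acyclic (G : sgraph) : Prop :=
  forall c : seq G, (2 < size c)%N -> ~ ucycle (@adj G) c.

Definition is_tree (G : sgraph) : Prop := is_connected G /\ is_acyclic G.

Definition is_clique (G : sgraph) (S : {set G}) : Prop :=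
  forall x y : G, x \in S -> y \in S -> x != y -> adj x y.

Definition max_induced_tree (G : sgraph) : nat :=
  \max_(S : {set G} | `[< is_tree (induced S) >]) #|S|.

(* Main.v *)
(** Every connected [K_r]-free graph [S] with a root [v] has an induced tree
    [T] through [v] with [#|S| <= r ^ (4 * #|T|)]; the proof is by induction on
    [n = #|S|]. Let [A] be the neighbourhood of [v], [B] the non-neighbours,
    and let [X a], for [a] in [A], be the union of the components of [B] that
    touch [a]. Because [S] is connected, the sets [X a] cover [B].
    - If [A] is large, Ramsey's theorem gives a large induced star at [v].
    - If some [X a] has at least about [n / r ^ 4] vertices, hang a tree of
      [a |: X a] from [v].
    - If [a], [b] in [A] are non-adjacent and [X a :\: X b], [X b :\: X a] both
      have at least [sqrt n] vertices, hang one tree from each of [a] and [b].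
    Otherwise order [A] by the size of [X a]: picking greedily the largest
    element and passing to its neighbours gives a clique [K] in [A], so that
    every [X a] is contained in the union of [X k], [k] in [K], up to fewer
    than [sqrt n] vertices. Since [#|K| < r] and [#|A|] is below
    [n ^ (1/4) / r], the sets [X a] are then too small to cover [B]. *)

Require Import Defs.
From mathcomp Require Import all_boot all_order all_algebra.
From mathcomp Require Import boolp reals exp zify.
Import Order.TTheory GRing.Theory Num.Theory.

Set Implicit Arguments.
Unset Strict Implicit.
Unset Printing Implicit Defensive.

(** * Rooted connected sets and trees inside a fixed graph *)

(** Living on all of [G], this relation lets the induction pass between subsets without nested
    subtypes. *)
Definition radj {G : sgraph} (S : {set G}) : rel G :=
  fun x y => [&& x \in S, y \in S & adj x y].

Definition rooted (G : sgraph) (S : {set G}) (v : G) : Prop :=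
  v \in S /\ forall x, x \in S -> connect (radj S) v x.

Definition acyclic_set (G : sgraph) (S : {set G}) : Prop :=
  forall c : seq G, 2 < size c -> uniq c -> cycle (@adj G) c ->
    ~ {subset c <= S}.

Definition rooted_tree (G : sgraph) (S : {set G}) (v : G) : Prop :=
  rooted S v /\ acyclic_set S.

Definition independent (G : sgraph) (S : {set G}) : Prop :=
  forall x y : G, x \in S -> y \in S -> ~~ adj x y.

Lemma radj_sym (G : sgraph) (S : {set G}) : symmetric (radj S).
Proof. by move=> x y; rewrite /radj adj_sym andbCA. Qed.

Lemma radj_sub (G : sgraph) (S T : {set G}) (x y : G) :
  S \subset T -> connect (radj S) x y -> connect (radj T) x y.
Proof.
move=> /subsetP sST; apply: connect_sub => u w /and3P[uS wS uw].
by apply: connect1; rewrite /radj !sST.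
Qed.

Lemma connect_invariant (T : finType) (e : rel T) (P : T -> Prop) (x y : T) :
  (forall u w, P u -> e u w -> P w) -> P x -> connect e x y -> P y.
Proof.
move=> Pe Px /connectP[p + ->]; elim: p x Px => //= z p IHp x Px /andP[xz zp].
by apply: IHp zp; apply: Pe xz.
Qed.

(** Without a crossing, [P] would propagate along [next c] from [x] to [y]. *)
Lemma next_crossing (T : finType) (c : seq T) (P : pred T) (x y : T) :
  uniq c -> x \in c -> y \in c -> P x -> ~~ P y ->
  exists u, [/\ u \in c, P u & ~~ P (next c u)].
Proof.
move=> cU xc yc Px Py; apply: contrapT => noX.
have stepP u : u \in c -> P u -> P (next c u).
  by move=> uc Pu; apply/negPn/negP => Pn; apply: noX; exists u.
have : fconnect (next c) x y by rewrite (fconnect_cycle (cycle_next cU) xc).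
move=> /iter_findex xy; case/negP: Py; rewrite -xy.
suff: P (iter (findex (next c) x y) (next c) x) /\
   iter (findex (next c) x y) (next c) x \in c by case.
elim: (findex _ _ _) => [//|k [Pk kc]] /=.
by rewrite mem_next; split => //; apply: stepP.
Qed.

(* A cycle meeting both sides would have to cross the joining edge once in each
   direction, hence consist of these two crossings only. *)
Lemma rooted_tree_join (G : sgraph) (S T : {set G}) (v x y : G) :
  rooted_tree S v -> rooted_tree T y -> x \in S -> adj x y ->
  (forall s t, s \in S -> t \in T -> s != t /\ (adj s t -> s = x /\ t = y)) ->
  rooted_tree (S :|: T) v.
Proof.
move=> [[vS vconn] acS] [[yT yconn] acT] xS xy one.
have disj z : z \in S -> z \notin T.
  by move=> zS; apply/negP => zT; have [/eqP] := one z z zS zT.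
split; first (split; first by rewrite inE vS).
  have vx : connect (radj (S :|: T)) v x.
    by apply: radj_sub (vconn x xS); exact: subsetUl.
  move=> z /setUP[zS|zT]; first by apply: radj_sub (vconn z zS); exact: subsetUl.
  apply: (connect_trans vx); apply: (@connect_trans _ _ y).
    by apply: connect1; rewrite /radj !inE xS yT xy orbT.
  by apply: radj_sub (yconn z zT); exact: subsetUr.
move=> c c2 cU cC cST.
have [cS|/allPn[t tc tS]] := boolP (all (mem S) c).
  by apply: (acS c) => //; apply/allP.
have [cT|/allPn[s sc sT]] := boolP (all (mem T) c).
  by apply: (acT c) => //; apply/allP.
have inS z : z \in c -> z \notin T -> z \in S.
  by move=> /cST /setUP[//|zT]; rewrite zT.
have inT z : z \in c -> z \notin S -> z \in T.
  by move=> /cST /setUP[zT|//]; rewrite zT.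
have [u [uc uS nuS]] :=
  next_crossing (P := mem S) cU sc tc (inS s sc sT) tS.
have [w [wc wT nwT]] :=
  next_crossing (P := mem T) cU tc sc (inT t tc tS) sT.
have nuc : next c u \in c by rewrite mem_next.
have nwc : next c w \in c by rewrite mem_next.
have [_ /(_ (next_cycle cC uc))[ux nuy]] := one u _ uS (inT _ nuc nuS).
have nwS := inS _ nwc nwT.
have [_] := one _ w nwS wT; rewrite adj_sym => /(_ (next_cycle cC wc))[nwx wy].
move: nuy nwx; rewrite ux wy => nxy nyx; have xc : x \in c by rewrite -ux.
(* Rotate the cycle to start [x, a, b]: then [a = y], and the successor [b] of [y] is [x] again,
   against uniqueness. *)
have [i p rc] := rot_to xc.
move: c2 (cU) nxy nyx.
rewrite -(size_rot i) -(rot_uniq i) -(next_rot i cU) -[next c y](next_rot i cU) rc.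
case: p {rc} => [|a [|b p]] //= _; rewrite !inE !negb_or eqxx.
move=> /andP[/and3P[xa xb _] _] ay.
rewrite -ay (negbTE (_ : a != x)); last by rewrite eq_sym.
by rewrite eqxx => bx; rewrite bx eqxx in xb.
Qed.

Lemma rooted_tree1 (G : sgraph) (v : G) : rooted_tree [set v] v.
Proof.
split; first by split; [rewrite inE | move=> x /set1P ->].
move=> [|a [|b c]] // _ /= /andP[+ _] _ cv.
have /set1P-> : a \in [set v] by apply: cv; rewrite inE eqxx.
have /set1P-> : b \in [set v] by apply: cv; rewrite !inE eqxx orbT.
by rewrite inE eqxx.
Qed.

(** Leaves are joined to [v] one at a time, each as a one-vertex tree. *)
Lemma rooted_tree_star (G : sgraph) (I : {set G}) (v : G) :
  independent I -> (forall x, x \in I -> adj v x) -> rooted_tree (v |: I) v.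
Proof.
have [k] := ubnP #|I|; elim: k I => // k IHk I Ik indI vI.
have [->|[x xI]] := set_0Vmem I; first by rewrite setU0; exact: rooted_tree1.
have -> : v |: I = (v |: I :\ x) :|: [set x].
  by rewrite -setUA [_ :|: [set x]]setUC setD1K.
have subI z : z \in I :\ x -> z \in I by case/setD1P.
apply: (@rooted_tree_join _ _ _ _ v x).
- apply: IHk; first by move: Ik; rewrite (cardsD1 x) xI.
    by move=> a b /subI aI /subI bI; apply: indI.
  by move=> a /subI; apply: vI.
- exact: rooted_tree1.
- by rewrite !inE eqxx.
- exact: vI.
- move=> s t /setU1P[->|sI] /set1P ->.
    by split=> //; apply/eqP => vx; have := vI x xI; rewrite vx adj_irrefl.
  split; first by case/setD1P: sI.
  by move=> sx; have := indI s x (subI _ sI) xI; rewrite sx.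
Qed.

(** * Ramsey bound and greedy cliques *)

Lemma clique_setU1 (G : sgraph) (K : {set G}) (u : G) :
  is_clique K -> (forall x, x \in K -> adj u x) -> is_clique (u |: K).
Proof.
move=> cK uK x y /setU1P[->|xK] /setU1P[->|yK]; first by rewrite eqxx.
- by move=> _; apply: uK.
- by move=> _; rewrite adj_sym; apply: uK.
- exact: cK.
Qed.

(** Recursion on a vertex [u]: cliques among its neighbours [N] extend by [u], so [r] drops by one
    there; independent sets among its non-neighbours [M] extend by [u]. *)
Lemma ramsey_independent (G : sgraph) (A : {set G}) (r : nat) :
  (forall K, is_clique K -> K \subset A -> #|K| < r) ->
  exists I : {set G}, [/\ independent I, I \subset A & #|A| < r ^ #|I|].
Proof.
have [k] := ubnP #|A|; elim: k A r => // k IHk A r Ak rA.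
have [->|[u uA]] := set_0Vmem A.
  by exists set0; split; rewrite ?cards0 ?expn0 // => x y; rewrite inE.
pose N := [set x in A | adj u x]; pose M := [set x in A :\ u | ~~ adj u x].
have NA : N \subset A by apply/subsetP => x /setIdP[].
have MA : M \subset A by apply/subsetP => x /setIdP[/setD1P[]].
have cardA : #|A| = (#|N| + #|M|).+1.
  have -> : A = u |: (N :|: M).
    apply/setP => x; rewrite !inE; have [->|_] //= := eqVneq x u.
    by case: (x \in A) => //=; case: (adj u x).
  rewrite cardsU1 cardsU !inE eqxx adj_irrefl !andbF /= add1n.
  have -> : N :&: M = set0.
    by apply/setP => x; rewrite !inE; case: (adj u x); rewrite !andbF.
  by rewrite cards0 subn0.
have r1 : 1 < r.
  have := rA [set u]; rewrite cards1; apply; last by rewrite sub1set.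
  by move=> x y /set1P -> /set1P ->; rewrite eqxx.
have [||I [indI IN NI]] := IHk N r.-1.
- by lia.
- move=> K cK KN.
  have uK : u \notin K.
    by apply/negP => /(subsetP KN) /setIdP[_]; rewrite adj_irrefl.
  have := rA (u |: K); rewrite cardsU1 uK => /(_ _ _)/=.
  suff [h1 h2] : is_clique (u |: K) /\ u |: K \subset A by move/(_ h1 h2); lia.
  split; last by rewrite subUset sub1set uA (subset_trans KN NA).
  by apply: clique_setU1 => // x /(subsetP KN) /setIdP[].
have [||J [indJ JM MJ]] := IHk M r.
- by lia.
- by move=> K cK KM; apply: rA => //; apply: subset_trans MA.
have uJ : u \notin J.
  by apply/negP => /(subsetP JM); rewrite !inE eqxx.
have indJu : independent (u |: J).
  move=> x y /setU1P[->|xJ] /setU1P[->|yJ]; rewrite ?adj_irrefl //.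
  - by have := subsetP JM _ yJ; rewrite inE => /andP[].
  - by rewrite adj_sym; have := subsetP JM _ xJ; rewrite inE => /andP[].
  - exact: indJ.
have cJ : #|u |: J| = #|J|.+1 by rewrite cardsU1 uJ.
have rE : r = r.-1.+1 by lia.
(* Keep the larger of [I] and [u |: J], of size [m] say: [r ^ m] splits into
   [(r - 1) * r ^ (m - 1)], which exceeds [#|N|], and [r ^ (m - 1)], which exceeds [#|M|]. *)
have [le|lt] := leqP #|I| #|J|.+1.
  exists (u |: J); split => //.
    by rewrite subUset sub1set uA (subset_trans JM MA).
  rewrite cJ expnS {1}rE mulSn cardA.
  have : r.-1 ^ #|I| <= r.-1 * r ^ #|J|.
    apply: (@leq_trans (r.-1 ^ #|J|.+1)); first by rewrite leq_pexp2l //; lia.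
    rewrite expnS leq_mul2l; apply/orP; right.
    by case: #|J| => // j; rewrite leq_exp2r ?leq_pred.
  lia.
exists I; split => //; first exact: subset_trans NA.
have [i iE] : exists i, #|I| = i.+1 by exists #|I|.-1; lia.
move: NI; rewrite iE expnS => NI; rewrite expnS {1}rE mulSn cardA.
have : r.-1 ^ i <= r ^ i by case: (i) => // j; rewrite leq_exp2r ?leq_pred.
have : r ^ #|J| <= r ^ i by rewrite leq_pexp2l //; lia.
nia.
Qed.

(** A maximiser [u] of [f] serves all its non-neighbours, itself included; recursing into its
    neighbours keeps the chosen vertices pairwise adjacent. *)
Lemma clique_cover (G : sgraph) (A : {set G}) (f : G -> nat) :
  exists K : {set G}, [/\ is_clique K, K \subset A &
    forall a, a \in A -> exists2 k, k \in K & ~~ adj a k /\ f a <= f k].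
Proof.
have [k] := ubnP #|A|; elim: k A => // k IHk A Ak.
have [->|[a0 a0A]] := set_0Vmem A.
  by exists set0; split=> // [x y|a]; rewrite inE.
have [u uA umax] : exists2 u, u \in A & forall a, a \in A -> f a <= f u.
  by case: (arg_maxnP f a0A) => u uA umax; exists u.
pose N := [set x in A | adj u x].
have NA : N \subset A by apply/subsetP => x /setIdP[].
have [|K [cK KN cov]] := IHk N.
  have : N \proper A.
    by apply/properP; split=> //; exists u; rewrite // inE adj_irrefl andbF.
  by move/proper_card; lia.
exists (u |: K); split.
- by apply: clique_setU1 => // x /(subsetP KN) /setIdP[].
- by rewrite subUset sub1set uA (subset_trans KN NA).
move=> a aA; have [ua|ua] := boolP (adj u a).
  have [|b bK ab] := cov a; first by rewrite inE aA.
  by exists b; rewrite ?inE ?bK ?orbT.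
by exists u; rewrite ?inE ?eqxx // adj_sym; split=> //; exact: umax.
Qed.

(** * Territories, the sets [X a] *)

Definition territory (G : sgraph) (B : {set G}) (a : G) : {set G} :=
  [set b | [exists c, [&& c \in B, adj a c & connect (radj B) c b]]].

Lemma territoryP (G : sgraph) (B : {set G}) (a b : G) :
  reflect (exists c, [/\ c \in B, adj a c & connect (radj B) c b])
    (b \in territory B a).
Proof.
rewrite inE; apply: (iffP existsP) => -[c].
  by case/and3P=> ? ? ?; exists c.
by case=> ? ? ?; exists c; apply/and3P.
Qed.

Lemma territory_closed (G : sgraph) (B : {set G}) (a : G) :
  closed (radj B) (mem (territory B a)).
Proof.
apply: intro_closed; first exact: (sym_connect_sym (@radj_sym _ B)).
move=> x y xy /territoryP[c [cB ac cx]]; apply/territoryP; exists c.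
by split=> //; apply: connect_trans cx (connect1 xy).
Qed.

Lemma territory_sub (G : sgraph) (B : {set G}) (a : G) : territory B a \subset B.
Proof.
apply/subsetP => b /territoryP[c [cB _ cb]].
by apply: (connect_invariant (P := fun z => z \in B)) cb => // u w _ /and3P[].
Qed.

(** A closed [W] removes whole components of [B], so paths from [a] into the others survive. *)
Lemma rooted_territory (G : sgraph) (B W : {set G}) (a : G) :
  closed (radj B) (mem W) -> rooted (a |: territory B a :\: W) a.
Proof.
move=> Wcl; split; first by rewrite !inE eqxx.
set Y := a |: _ => x /setU1P[->//|/setDP[xX xW]].
have /territoryP[c [cB ac cx]] := xX.
have cW : c \notin W by have := closed_connect Wcl cx; rewrite /= => ->.
have cX : c \in territory B a by apply/territoryP; exists c.
have memY z : z \in territory B a -> z \notin W -> z \in Y.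
  by move=> zX zW; rewrite !inE in zX *; rewrite zW zX orbT.
have aY : a \in Y by rewrite !inE eqxx.
pose P z := [/\ z \in territory B a, z \notin W & connect (radj Y) a z].
suff: P x by case.
apply: (connect_invariant (P := P)) cx; last first.
  by split=> //; apply: connect1; rewrite /radj aY ac memY.
move=> u w [uX uW au] uw.
have wX : w \in territory B a.
  by have := @territory_closed _ _ a _ _ uw; rewrite /= => <-.
have wW : w \notin W by have := Wcl _ _ uw; rewrite /= => <-.
split=> //; apply: connect_trans au (connect1 _).
by rewrite /radj !memY //=; case/and3P: uw.
Qed.

(** A path from [v] can enter [B] only from a vertex of [A], and then stays in one territory as long
    as it stays in [B]. *)
Lemma territory_cover (G : sgraph) (S : {set G}) (v b : G) :
  let A := [set x in S | adj v x] in
  let B := S :\: (v |: A) in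
  rooted S v -> b \in B -> exists2 a, a \in A & b \in territory B a.
Proof.
move=> A B [vS vconn] bB; have /setDP[bS bvA] := bB.
pose P z := z \in v |: A \/ exists2 a, a \in A & z \in territory B a.
suff: P b by case=> //; rewrite (negbTE bvA).
apply: (connect_invariant (P := P)) (vconn b bS); last by left; rewrite !inE eqxx.
move=> u w Pu /and3P[uS wS uw].
have [wvA|wvA] := boolP (w \in v |: A); [by left | right].
have wB : w \in B by rewrite inE wvA.
case: Pu => [/setU1P[uv|uA]|[a aA uX]].
- by case/negP: wvA; rewrite !inE wS -uv uw orbT.
- by exists u => //; apply/territoryP; exists w.
- exists a => //; have uB := subsetP (territory_sub B a) u uX.
  by have := @territory_closed _ B a u w; rewrite /radj uB wB uw /= => <-.
Qed.

(** * Counting, and the induction on the size of [S] *)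

Lemma card_bigcup_le (T I : finType) (A : {set I}) (F : I -> {set T}) :
  #|\bigcup_(i in A) F i| <= \sum_(i in A) #|F i|.
Proof.
elim/big_rec2: _ => [|i m X _ le]; first by rewrite cards0.
by apply: leq_trans (leq_card_setU _ _) _; rewrite leq_add2l.
Qed.

Lemma sum_card_le (I : finType) (A : {set I}) (f : I -> nat) (c n : nat) :
  (forall i, i \in A -> c * f i <= n) -> c * \sum_(i in A) f i <= #|A| * n.
Proof.
move=> cf; rewrite big_distrr /= -sum_nat_const; exact: leq_sum.
Qed.

Lemma rooted_tree_large (G : sgraph) (r : nat) (S : {set G}) (v : G) :
  4 <= r -> (forall K : {set G}, is_clique K -> #|K| < r) -> rooted S v ->
  exists T : {set G}, [/\ rooted_tree T v, T \subset S & #|S| <= r ^ (4 * #|T|)].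
Proof.
move=> r4 cliq; have [k] := ubnP #|S|; elim: k S v => // k IHk S v Sk vS.
set n := #|S|.
have r0 : 0 < r by lia.
pose A := [set x in S | adj v x]; pose B := S :\: (v |: A).
have vIS := proj1 vS.
have AS : A \subset S by apply/subsetP => x /setIdP[].
have adjA a : a \in A -> adj v a by case/setIdP.
have vA : v \notin A by rewrite inE adj_irrefl andbF.
have BS : B \subset S by exact: subsetDl.
have vB b : b \in B -> v != b /\ ~~ adj v b.
  by case/setDP=> bS; rewrite !inE bS negb_or /= => /andP[bv nvb]; rewrite eq_sym.
have AB a : a \in A -> a \notin B by move=> aA; rewrite inE setUC inE aA.
have [small|big] := leqP n (r ^ 4).
  exists [set v]; rewrite cards1 muln1; split=> //; first exact: rooted_tree1.
  by rewrite sub1set.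
have cardS : n = (#|A| + #|B|).+1.
  rewrite /n -(cardsID (v |: A) S) (setIidPr _); last by rewrite subUset sub1set vIS.
  by rewrite cardsU1 vA.
have [I [indI IA AI]] := @ramsey_independent G A r (fun K cK _ => cliq K cK).
(* The threshold fits the star: [#|A| < r ^ #|I|] gives [#|A| * r <= r ^ (#|I| + 1)], and the star
   has [#|I| + 1] vertices. *)
have [star|Asmall] := leqP n ((#|A| * r) ^ 4).
  exists (v |: I); split.
  - by apply: rooted_tree_star => // x xI; apply/adjA/(subsetP IA).
  - by rewrite subUset sub1set vIS (subset_trans IA).
  - apply: (leq_trans star); rewrite cardsU1 (contra (subsetP IA v) vA).
    by rewrite [4 * _]mulnC expnM leq_exp2r // add1n expnS mulnC leq_mul // ltnW.
pose X := territory B.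
have XB a : X a \subset B := territory_sub B a.
have Xadj a b : adj a b -> b \in B -> b \in X a.
  by move=> ab bB; apply/territoryP; exists b.
have sub a W : a \in A -> a |: X a :\: W \subset S /\ v \notin a |: X a :\: W.
  move=> aA; split.
    rewrite subUset sub1set (subsetP AS) //=.
    by apply: subset_trans (subsetDl _ _) (subset_trans (XB a) BS).
  rewrite !in_setU1 in_setD negb_or; apply/andP; split.
    by apply: contraNneq vA => ->.
  by apply/negP => /andP[_ /(subsetP (XB a)) /vB[]]; rewrite eqxx.
(* The inequality is strict because the root [a] lies outside [B] and is counted as well. *)
have recur a (W : {set G}) : a \in A -> closed (radj B) (mem W) ->
    exists T, [/\ rooted_tree T a, T \subset a |: X a :\: W &
                  #|X a :\: W| < r ^ (4 * #|T|)].
  move=> aA Wcl; have [YS vY] := sub a W aA.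
  have [||T [TT TY YT]] := IHk (a |: X a :\: W) a.
  - have : a |: X a :\: W \proper S by apply/properP; split => //; exists v.
    by move/proper_card => /leq_trans; apply.
  - exact: rooted_territory.
  exists T; split=> //; move: YT; rewrite cardsU1.
  by rewrite (contra (subsetP (subset_trans (subsetDl _ W) (XB a)) a) (AB a aA)).
(* Apart from [a], [T] lies in [B], away from the neighbours of [v]; [v = v] matches the hypothesis
   of [rooted_tree_join]. *)
have joinv T a Y : rooted_tree T a -> T \subset a |: X a :\: Y -> a \in A ->
    forall t, t \in T -> v != t /\ (adj v t -> v = v /\ t = a).
  move=> TT TY aA t /(subsetP TY)
    /setU1P[->|/setDP[/(subsetP (XB a)) /vB[vt nvt] _]].
    by split=> //; apply: contraNneq vA => ->.
  by split=> //; rewrite (negbTE nvt).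
have extend T a Y : rooted_tree T a -> T \subset a |: X a :\: Y -> a \in A ->
    rooted_tree (v |: T) v /\ v |: T \subset S /\ #|v |: T| = #|T|.+1.
  move=> TT TY aA; have [YS vY] := sub a Y aA; split; last split.
  - apply: (@rooted_tree_join _ _ _ _ v a) => //;
      [exact: rooted_tree1|by rewrite inE|exact: adjA|].
    by move=> s t /set1P ->; exact: (joinv _ _ _ TT TY aA).
  - by rewrite subUset sub1set vIS (subset_trans TY).
  - by rewrite cardsU1 (contra (subsetP TY v) vY).
(* The factor [r ^ 4] pays for the one additional vertex [v]. *)
have [[a aA aX]|single] := pselect (exists2 a, a \in A & n <= r ^ 4 * #|X a|.+1).
  have [|T [TT TY]] := recur a set0 aA; first by move=> x y; rewrite /= !inE.
  have [vT [vTS cT]] := extend T a _ TT TY aA.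
  rewrite setD0 => XT; exists (v |: T); split=> //.
  by rewrite cT mulnS expnD; apply: leq_trans aX _; rewrite leq_mul2l XT orbT.
have [[a [b [aA bA nab [ab ba]]]]|pair] := pselect (exists a b,
    [/\ a \in A, b \in A, ~~ adj a b &
    n <= #|X a :\: X b| ^ 2 /\ n <= #|X b :\: X a| ^ 2]).
  have [T [TT TY cT]] := recur a (X b) aA (@territory_closed _ B b).
  have [U [UU UY cU]] := recur b (X a) bA (@territory_closed _ B a).
  have [vT [vTS cvT]] := extend T a _ TT TY aA.
  have [_ [vUS cvU]] := extend U b _ UU UY bA.
  have US : U \subset S by apply: subset_trans vUS; exact: subsetUr.
  have neab : a != b.
    by apply/eqP => eab; move: ab; rewrite eab setDv cards0 cardS.
  (* An edge from [a] or from [X a] to a vertex of [X b :\: X a] would put that vertex in [X a];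
     symmetrically for [b]. *)
  have cross s t : s \in T -> t \in U -> s != t /\ ~~ adj s t.
    move=> /(subsetP TY) /setU1P[->|/setDP[sX sX']]
      /(subsetP UY) /setU1P[->|/setDP[tX tX']].
    - by [].
    - have tB := subsetP (XB b) _ tX; split.
        by apply: contraNneq (AB a aA) => ->.
      by apply: contra tX' => at_; apply: Xadj.
    - have sB := subsetP (XB a) _ sX; split.
        by apply: contraTneq sB => ->; exact: AB.
      by apply: contra sX'; rewrite adj_sym => bs; apply: Xadj.
    - split; first by apply: contraNneq sX' => ->.
      apply: contra sX' => st.
      have := @territory_closed _ B b s t.
      by rewrite /radj (subsetP (XB a) _ sX) (subsetP (XB b) _ tX) st /= => ->.
  have vU : forall t, t \in U -> v != t /\ (adj v t -> v = v /\ t = b).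
    exact: (joinv _ _ _ UU UY bA).
  exists ((v |: T) :|: U); split.
  - apply: (@rooted_tree_join _ _ _ _ v b) => //; [by rewrite !inE eqxx|exact: adjA|].
    move=> s t /setU1P[->|sT] tU; first exact: vU.
    by have [st nst] := cross s t sT tU; split=> //; rewrite (negbTE nst).
  - by rewrite subUset vTS US.
  - have -> : #|(v |: T) :|: U| = (#|T| + #|U|).+1.
      rewrite cardsU cvT (_ : _ :&: _ = set0) ?cards0 ?subn0 ?addSn //.
      apply/setP => z; rewrite !inE; apply/negP => /andP[/orP[/eqP->|zT] zU].
        by have [/eqP] := vU v zU.
      by have [/eqP] := cross z z zT zU.
    rewrite mulnS mulnDr expnD (expnD _ (4 * _)).
    (* Both squares are at least [n], hence so is the product; the bounds for [T] and [U] multiply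
       as their sizes add. *)
    have le : n <= #|X a :\: X b| * #|X b :\: X a|.
      by rewrite -leq_sqr expnMn -mulnn leq_mul.
    apply: (leq_trans le); apply: leq_trans (leq_pmull _ _);
      last by rewrite expn_gt0 r0.
    exact: leq_mul (ltnW cT) (ltnW cU).
have [K [cK KA cov]] := clique_cover A (fun a => #|X a|).
pose Z := \bigcup_(k in K) X k.
(* For a non-neighbour [c] of [a] with [#|X a| <= #|X c|], [X a :\: X c] is the smaller difference,
   so its square is below [n] once the two-tree case is excluded. *)
have Esmall a : a \in A -> #|X a :\: Z| ^ 2 < n.
  move=> aA; have [c cKc [nac le]] := cov a aA.
  have cA := subsetP KA _ cKc.
  have leE : #|X a :\: Z| <= #|X a :\: X c|.
    by apply/subset_leq_card/setDS/bigcup_sup.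
  apply: (@leq_ltn_trans (#|X a :\: X c| ^ 2)); first by rewrite leq_sqr.
  rewrite ltnNge; apply/negP => big1; apply: pair.
  exists a, c; split=> //; split=> //.
  apply: leq_trans big1 _; rewrite leq_sqr !cardsD [X c :&: _]setIC.
  exact: leq_sub2r.
have cover : B \subset Z :|: \bigcup_(a in A) (X a :\: Z).
  apply/subsetP => b bB; have [a aA bX] := territory_cover vS bB.
  rewrite inE; have [//|bZ] /= := boolP (b \in Z).
  by apply/bigcupP; exists a; rewrite // inE bZ.
have cB : #|B| <= \sum_(k in K) #|X k| + \sum_(a in A) #|X a :\: Z|.
  apply: leq_trans (subset_leq_card cover) _.
  by apply: leq_trans (leq_card_setU _ _) _; apply: leq_add; exact: card_bigcup_le.
have sK : r ^ 4 * \sum_(k in K) #|X k| <= #|K| * n.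
  apply: sum_card_le => i iK; rewrite leqNgt; apply/negP => lt; apply: single.
  exists i; first exact: (subsetP KA).
  by apply: leq_trans (ltnW lt) _; rewrite leq_mul2l leqnSn orbT.
(* Termwise, compare squares: [(#|A| * r) ^ 2] and [#|X i :\: Z| ^ 2] are both at most [n]. *)
have sA : (#|A| * r) * \sum_(a in A) #|X a :\: Z| <= #|A| * n.
  apply: sum_card_le => i iA.
  have e2 := Esmall i iA; rewrite -leq_sqr expnMn -[n ^ 2]mulnn.
  apply: leq_mul (ltnW e2); apply: leq_trans (ltnW Asmall).
  rewrite (expnM _ 2 2) -[X in _ <= X]mulnn.
  by case: ((_ * _) ^ 2) => // m; rewrite leq_pmulr.
have Kr := cliq K cK.
(* [#|K| < r] cancels one factor of [r ^ 4], leaving [r ^ 3 >= 64]. *)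
have KS : 64 * \sum_(k in K) #|X k| <= n.
  rewrite -(leq_pmul2l r0); apply: leq_trans (_ : #|K| * n <= _);
    last by rewrite leq_mul2r ltnW ?orbT.
  apply: leq_trans sK; rewrite mulnA leq_mul2r; apply/orP; right.
  by rewrite expnS leq_mul2l (leq_exp2r 4 r (isT : 0 < 3)) r4 orbT.
have sA' : 4 * \sum_(a in A) #|X a :\: Z| <= n.
  have [A0|A0] := posnP #|A|; first by rewrite (cards0_eq A0) big_set0.
  rewrite -(leq_pmul2l A0); apply: leq_trans sA; rewrite mulnA leq_mul2r.
  by rewrite leq_mul2l r4 !orbT.
have r256 : 256 <= r ^ 4 by rewrite (leq_exp2r 4 r (isT : 0 < 4)).
have sA4 : 256 * #|A| <= n.
  apply: leq_trans (ltnW Asmall); rewrite expnMn mulnC; apply: leq_mul.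
    by rewrite -[X in X <= _]expn1; case: #|A| => // m; rewrite leq_pexp2l.
  exact: r256.
(* Now [n <= 1 + n/256 + n/64 + n/4], impossible for [n > 256]. *)
exfalso; move: cB KS sA' sA4 (leq_ltn_trans r256 big); rewrite cardS; clear; lia.
Qed.

(** * Transfer to induced subgraphs and logarithms *)

Lemma rooted_tree_induced (G : sgraph) (T : {set G}) (v : G) :
  rooted_tree T v -> is_tree (induced T).
Proof.
move=> [[vT vconn] acT]; split; last first.
  move=> c c2 /andP[cC cU]; apply: (acT (map val c)).
  - by rewrite size_map.
  - by rewrite map_inj_uniq //; exact: val_inj.
  - by rewrite cycle_map.
  - by move=> x /mapP[y _ ->]; exact: valP.
have vcn x (xT : x \in T) :
    connect (@adj (induced T)) (exist _ v vT) (exist _ x xT).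
  (* Quantifying over the membership proof turns this into an invariant on vertices of [G]. *)
  pose P z := forall zT : z \in T,
    connect (@adj (induced T)) (exist _ v vT) (exist _ z zT).
  have vx := vconn x xT; move: x vx xT.
  suff: forall x, connect (radj T) v x -> P x by [].
  move=> x; apply: connect_invariant => [u w Pu /and3P[uT wT uw] zT|zT].
    exact: connect_trans (Pu uT)
      (connect1 (uw : @adj (induced T) (exist _ u uT) (exist _ w zT))).
  by rewrite (bool_irrelevance zT vT).
split; first by apply/card_gt0P; exists (exist _ v vT).
have csym : connect_sym (@adj (induced T)).
  by apply: sym_connect_sym; exact: (@adj_sym (induced T)).
move=> [x xT] [y yT]; apply: connect_trans (vcn y yT).
by rewrite csym.
Qed.

Lemma max_induced_tree_large (r : nat) (G : sgraph) :
  4 <= r -> is_connected G ->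
  ~ (exists S : {set G}, is_clique S /\ #|S| = r) ->
  #|G| <= r ^ (4 * max_induced_tree G).
Proof.
move=> r4 [/card_gt0P[v _] conn] noK.
(* Only size exactly [r] is excluded, but a larger clique contains one of size [r]. *)
have cliq (K : {set G}) : is_clique K -> #|K| < r.
  move=> cK; rewrite ltnNge; apply/negP => rK; apply: noK.
  have [I rI IK] : exists2 I : {set G}, #|I| = r & I \subset K.
    have /card_geqP[s [sU sr sK]] := rK.
    exists [set x in s]; first by rewrite cardsE (card_uniqP sU).
    by apply/subsetP => x; rewrite inE => /sK.
  by exists I; split=> // x y /(subsetP IK) xK /(subsetP IK) yK; apply: cK.
have [|T [TT _]] := @rooted_tree_large G r setT v r4 cliq.
  split; first by rewrite inE.
  move=> x _; apply: connect_sub (conn v x) => a b ab.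
  by apply: connect1; rewrite /radj !inE.
rewrite cardsT => /leq_trans; apply; rewrite leq_pexp2l ?(leq_trans _ r4) //.
rewrite leq_mul2l /=.
by apply: leq_bigmax_cond; apply/asboolP; exact: rooted_tree_induced TT.
Qed.

Local Open Scope ring_scope.

Theorem theorem1p2 (R : realType) (r n : nat) (G : sgraph)
    (hr : (4 <= r)%N) (hn : #|G| = n) (hconn : is_connected G)
    (hclique : ~ exists S : {set G}, is_clique S /\ #|S| = r) :
  ln (n%:R : R) / (4 * ln (r%:R : R)) <= (max_induced_tree G)%:R.
Proof.
have n0 : (0 < n)%N by rewrite -hn; case: hconn.
have le := max_induced_tree_large hr hconn hclique.
have r1 : 1 < r%:R :> R by rewrite ltr1n; lia.
have r0 : 0 < r%:R :> R by apply: lt_trans r1.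
rewrite ler_pdivrMr; last by rewrite mulr_gt0 // ln_gt0.
rewrite mulrA -natrM mulrC mulr_natr mulnC -lnXn //.
rewrite ler_ln ?posrE ?exprn_gt0 // ?ltr0n //.
by rewrite -natrX ler_nat -hn.
Qed.
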